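(* Let $(Y,d)$ be a nonempty proper metric space. Then for each $k\in\mathbb{N}$ there exist a proper metric space $(X^{(k)},\bar d)$, a basepoint $e\in X^{(k)}$, and a sequence of scaling factors $\alpha=(\alpha_n)_{n\in\mathbb{N}}$ (positive real numbers tending to infinity) such that for every non-principal ultrafilter $\mu$ on $\mathbb{N}$ there is an isometry $$\mathrm{Cone}^k_\mu(X^{(k)},e,\alpha)\cong Y .$$
   Context: A metric space is proper if all its closed balls are compact. An isometry is a surjective distance-preserving map. Ultralimits: for a non-principal ultrafilter $\mu$ on $\mathbb{N}$ and a bounded real sequence $(r_n)$, $\lim_\mu r_n$ is the unique $a\in\mathbb{R}$ such that for every neighbourhood $U$ of $a$ one has $\{n: r_n\in U\}\in\mu$. A property holds $\mu$-almost everywhere if the set of indices where it holds lies in $\mu$. Asymptotic cone: let $(X,d)$ be a metric space, $e\in X$ a basepoint, $\mu$ a non-principal ultrafilter on $\mathbb{N}$, and $\alpha=(\alpha_n)$ a sequence of positive reals tending to infinity. Consider all sequences $(x_n)$ in $X$ for which $d(x_n,e)/\alpha_n$ is bounded $\mu$-almost everywhere (i.e. there is $C>0$ with $\{n: d(x_n,e)/\alpha_n<C\}\in\mu$). On this set, $d_\infty((x_n),(y_n)):=\lim_\mu d(x_n,y_n)/\alpha_n$ is a pseudo-metric. $\mathrm{Cone}_\mu(X,e,\alpha)$ is the metric space obtained by identifying sequences at $d_\infty$-distance $0$, with the induced metric $d_\infty$. It has a canonical basepoint $\hat e$, the class of the constant sequence $(e,e,e,\ldots)$. Iterated cones: $\mathrm{Cone}^0_\mu(X,e,\alpha):=X$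 (with basepoint $e$), and for $i\ge 0$, $\mathrm{Cone}^{i+1}_\mu(X,e,\alpha):=\mathrm{Cone}_\mu\big(\mathrm{Cone}^i_\mu(X,e,\alpha),\hat e,\alpha\big)$, where $\hat e$ denotes the canonical basepoint of $\mathrm{Cone}^i_\mu(X,e,\alpha)$ (equal to $e$ for $i=0$). The same $\mu$ and $\alpha$ are used at every stage. *)

(* Defs.v *)
From HB Require Import structures.
From mathcomp Require Import all_boot all_order all_algebra generic_quotient.
From mathcomp Require Import all_classical all_reals all_analysis.

Set Implicit Arguments.
Unset Strict Implicit.
Unset Printing Implicit Defensive.

Import Order.TTheory GRing.Theory Num.Theory.
Import numFieldNormedType.Exports.

Local Open Scope classical_set_scope.
Local Open Scope ring_scope.
Local Open Scope quotient_scope.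

(* The library's [closed_ball] is the closure of the open ball, which can be
   strictly smaller than the closed ball of a metric space. *)
Definition proper_metric (R : realType) (X : metricType R) : Prop :=
  forall (x : X) (r : R), compact [set y : X | mdist x y <= r].

Definition is_isometry (R : realType) (X Y : metricType R) (f : X -> Y) : Prop :=
  (forall x y : X, mdist (f x) (f y) = mdist x y) /\
  (forall y : Y, exists x : X, f x = y).

Definition non_principal (mu : set_system nat) : Prop :=
  forall n : nat, mu <> principal_filter n.

Section Ultralimit.
Context (R : realType) (mu : set_system nat).

Definition ulim (r : nat -> R) : R := lim (r n @[n --> mu]).

Context {muU : UltraFilter mu}.

Lemma ulimE (r : nat -> R) (a : R) : r n @[n --> mu] --> a -> ulim r = a.
Proof. by move=> ra; apply: cvg_lim. Qed.

Lemma ulim_cvg (r : nat -> R) (a b : R) :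
  mu [set n | a <= r n <= b] -> r n @[n --> mu] --> ulim r.
Proof.
move=> mur.
have rU : UltraFilter (r n @[n --> mu]).
  constructor; first exact: fmap_proper_filter.
  move=> G GP rG; apply/seteqP; split=> // A GA.
  have [//|nA] := in_ultra_setVsetC (r @^-1` A) muU.
  have GnA : G (~` A) by apply: rG.
  suff : G set0 by move=> /filter_not_empty.
  by rewrite -(setICr A); exact: filterI.
have := @segment_compact R a b; rewrite compact_ultra => /(_ _ rU) [].
  suff : mu (r @^-1` `[a, b]) by [].
  by apply: filterS mur => n /=; rewrite in_itv.
by move=> p [_ /= rp]; rewrite (ulimE rp).
Qed.

End Ultralimit.

Section Cone.
Context (R : realType) (X : metricType R) (e : X).
Context (mu : set_system nat) (muU : UltraFilter mu).
Context (alpha : nat -> R) (alpha_gt0 : forall n, 0 < alpha n).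

Definition admissible (x : nat -> X) : Prop :=
  exists2 C : R, 0 < C & mu [set n | mdist (x n) e / alpha n < C].

Definition cone_seq : Type := {x : nat -> X | `[< admissible x >]}.

HB.instance Definition _ := gen_eqMixin cone_seq.
HB.instance Definition _ := gen_choiceMixin cone_seq.

Definition dinfty (x y : cone_seq) : R :=
  ulim mu (fun n => mdist (sval x n) (sval y n) / alpha n).

Lemma dinfty_cvg (x y : cone_seq) :
  mdist (sval x n) (sval y n) / alpha n @[n --> mu] --> dinfty x y.
Proof.
have /asboolP[C C0 Cx] := svalP x; have /asboolP[D D0 Dy] := svalP y.
apply: (@ulim_cvg _ _ _ _ 0 (C + D)).
apply: filterS (filterI Cx Dy) => n [/= Cxn Dyn].
rewrite divr_ge0 ?mdist_ge0 ?(ltW (alpha_gt0 n))//=.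
apply: le_trans (ltW (ltrD Cxn Dyn)).
rewrite -mulrDl ler_pM2r ?invr_gt0//.
by rewrite (metric_sym (sval y n)) metric_triangle.
Qed.

Lemma dinftyxx (x : cone_seq) : dinfty x x = 0.
Proof.
apply: ulimE; under eq_fun do rewrite mdistxx mul0r.
exact: cvg_cst.
Qed.

Lemma dinfty_sym (x y : cone_seq) : dinfty x y = dinfty y x.
Proof.
by congr ulim; apply/funext => n; rewrite metric_sym.
Qed.

Lemma dinfty_ge0 (x y : cone_seq) : 0 <= dinfty x y.
Proof.
apply: (cvgr_to_ge (@dinfty_cvg x y)).
by apply: nearW => n; rewrite /= divr_ge0 ?mdist_ge0 ?(ltW (alpha_gt0 n)).
Qed.

Lemma dinfty_triangle (y x z : cone_seq) :
  dinfty x z <= dinfty x y + dinfty y z.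
Proof.
apply: (ler_cvg_to (@dinfty_cvg x z)
  (cvgD (@dinfty_cvg x y) (@dinfty_cvg y z))).
apply: nearW => n /=.
by rewrite -mulrDl ler_pM2r ?invr_gt0// metric_triangle.
Qed.

Definition cone_rel (x y : cone_seq) : bool := dinfty x y == 0.

Lemma cone_rel_refl : reflexive cone_rel.
Proof. by move=> x; rewrite /cone_rel dinftyxx. Qed.

Lemma cone_rel_sym : symmetric cone_rel.
Proof. by move=> x y; rewrite /cone_rel dinfty_sym. Qed.

Lemma cone_rel_trans : transitive cone_rel.
Proof.
move=> y x z /eqP xy /eqP yz; rewrite /cone_rel eq_le dinfty_ge0 andbT.
by rewrite (le_trans (dinfty_triangle y x z))// xy yz addr0.
Qed.

Canonical cone_equiv :=
  EquivRel cone_rel cone_rel_refl cone_rel_sym cone_rel_trans.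

Definition cone : Type := {eq_quot cone_equiv}.

HB.instance Definition _ := Choice.on cone.
HB.instance Definition _ := EqQuotient.on cone.

(* Computed on representatives; [cone_distE] shows it is independent of them. *)
Definition cone_dist (p q : cone) : R := dinfty (repr p) (repr q).

Lemma cone_distE (x y : cone_seq) :
  cone_dist (\pi_cone x) (\pi_cone y) = dinfty x y.
Proof.
have r0 (z : cone_seq) : dinfty (repr (\pi_cone z)) z = 0.
  by apply/eqP; rewrite -[_ == 0]/(cone_equiv _ _) -eqmodE reprK.
have le (a b a' b' : cone_seq) : dinfty a a' = 0 -> dinfty b b' = 0 ->
    dinfty a b <= dinfty a' b'.
  move=> aa bb; apply: le_trans (dinfty_triangle a' a b) _.
  rewrite aa add0r; apply: le_trans (dinfty_triangle b' a' b) _.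
  by rewrite (dinfty_sym b') bb addr0.
by apply/eqP; rewrite eq_le !le// dinfty_sym.
Qed.

Lemma cone_distxx (p : cone) : cone_dist p p = 0.
Proof. exact: dinftyxx. Qed.

Lemma cone_dist_positivity (p q : cone) : cone_dist p q = 0 -> p = q.
Proof.
by rewrite -(reprK p) -(reprK q) cone_distE => /eqP pq; apply/eqmodP.
Qed.

Lemma cone_dist_sym (p q : cone) : cone_dist p q = cone_dist q p.
Proof. exact: dinfty_sym. Qed.

Lemma cone_dist_triangle (q p s : cone) :
  cone_dist p s <= cone_dist p q + cone_dist q s.
Proof. exact: dinfty_triangle. Qed.

HB.instance Definition _ := @isMetric.Build R cone
  cone_dist cone_distxx cone_dist_positivity cone_dist_sym cone_dist_triangle.

Lemma admissible_cst : `[< admissible (fun=> e) >].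
Proof.
apply/asboolP; exists 1 => //; apply: filterS filterT => n _ /=.
by rewrite mdistxx mul0r.
Qed.

Definition cone_base : cone := \pi_cone (exist _ (fun=> e) admissible_cst).

End Cone.

Record pointed_metric (R : realType) := PointedMetric {
  pm_space : metricType R ;
  pm_base : pm_space
}.

Fixpoint iter_cone (R : realType) (X : metricType R) (e : X)
    (mu : set_system nat) (muU : UltraFilter mu)
    (alpha : nat -> R) (alpha_gt0 : forall n, 0 < alpha n) (k : nat) :
    pointed_metric R :=
  match k with
  | 0 => PointedMetric e
  | i.+1 =>
    let C := iter_cone e muU alpha_gt0 i in
    PointedMetric (cone_base (pm_base C) muU alpha_gt0)
  end.

(* Main.v *)
(* Fix the super-exponential scale alpha_n = ((n+1)!)^2.  Given (Y, y0), glue at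
   their basepoint the copies, scaled by alpha_n, of the closed annuli
   1/(n+1) <= d(y0, y) <= n+1 of Y.  Seen from distance alpha_n, the copies of
   index m < n collapse to the basepoint and those of index m > n escape to
   infinity, so only an ever larger annulus of Y remains: the cone of the wedge
   is (Y, y0), whatever the ultrafilter.  As alpha does not depend on Y, the
   construction can be iterated k times with the same scale. *)
Require Import Defs.
From mathcomp Require Import all_boot all_order all_algebra.
From mathcomp Require Import all_classical all_reals all_analysis.
Import numFieldNormedType.Exports.
Local Open Scope classical_set_scope.
Local Open Scope ring_scope.
From HB Require Import structures.
From mathcomp Require Import generic_quotient lra.
Import Order.TTheory GRing.Theory Num.Theory.

Set Implicit Arguments.
Unset Strict Implicit.
Unset Printing Implicit Defensive.

(** * Ultrafilters: images and cofinite sets *)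

Lemma fmap_ultra (S T : Type) (f : S -> T) (F : set_system S) :
  UltraFilter F -> UltraFilter (f @ F).
Proof.
move=> FU; constructor; first exact: fmap_proper_filter.
move=> G GP fG; apply/seteqP; split=> // A GA.
have [//|nA] := in_ultra_setVsetC (f @^-1` A) FU.
have GnA : G (~` A) by apply: fG.
suff : G set0 by move=> /filter_not_empty.
by rewrite -(setICr A); exact: filterI.
Qed.

(** A singleton in [mu] would make [mu] principal by maximality. So [mu] contains the complement of
    every point, hence every tail. *)
Lemma non_principal_cofinite (mu : set_system nat) :
  UltraFilter mu -> non_principal mu -> \oo `<=` mu.
Proof.
move=> muU npmu.
have muC n : mu (~` [set n]).
  have [mun|//] := in_ultra_setVsetC [set n] muU.
  case: (npmu n); apply/esym/max_filter; first exact: principal_filter_proper.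
  move=> A muA; apply/principal_filterP.
  by have [_ [/[swap] ->]] := filter_ex (filterI muA mun).
have mu_ge N : mu [set n | (N <= n)%N].
  elim: N => [|N IHN]; first by apply: filterS filterT.
  apply: filterS (filterI IHN (muC N)) => n /= [Nn nN].
  by rewrite ltn_neqAle Nn andbT eq_sym; apply/eqP.
by move=> A [N _ NA]; apply: filterS (mu_ge N).
Qed.

(** * Continuity of the distance *)

Section Metric.
Context (R : realType).

Lemma mdist_diff_le (X : metricType R) (a b c d : X) :
  `|mdist a b - mdist c d| <= mdist a c + mdist b d.
Proof.
have := metric_triangle a c b; have := metric_triangle c d b.
have := metric_triangle c a d; have := metric_triangle a b d.
rewrite (metric_sym c a) (metric_sym d b) ler_norml; lra.
Qed.

Lemma cvg_mdist (X : metricType R) (T : Type) (F : set_system T)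
 {FF : Filter F} (u v : T -> X) (a b : X) :
  u @ F --> a -> v @ F --> b -> mdist (u t) (v t) @[t --> F] --> mdist a b.
Proof.
move=> /metricType_numDomainType.cvgrPdist_lt ua.
move=> /metricType_numDomainType.cvgrPdist_lt vb.
apply/cvgrPdist_lt => r r0; have r20 : 0 < r / 2 by rewrite divr_gt0.
near=> t.
apply: le_lt_trans (mdist_diff_le _ _ _ _) _.
rewrite (splitr r) ltrD//; near: t; [exact: ua|exact: vb].
Unshelve. all: by end_near. Qed.

Lemma closed_mdist_le (X : metricType R) (x : X) (r : R) :
  closed [set y : X | mdist x y <= r].
Proof.
apply: (@preimage_closed _ _ (mdist x) [set s | s <= r]); last exact: closed_le.
by move=> y _; apply: cvg_mdist; [exact: cvg_cst|exact: cvg_id].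
Qed.

Lemma closed_mdist_ge (X : metricType R) (x : X) (r : R) :
  closed [set y : X | r <= mdist x y].
Proof.
apply: (@preimage_closed _ _ (mdist x) [set s | r <= s]); last exact: closed_ge.
by move=> y _; apply: cvg_mdist; [exact: cvg_cst|exact: cvg_id].
Qed.

End Metric.

(** * Cones computed from maps [phi n] that are almost isometric at scale [alpha n] *)

Section ConeOfApproximations.
Context (R : realType) (X Y : metricType R) (e : X) (y0 : Y).
Context (alpha : nat -> R) (alpha_gt0 : forall n, 0 < alpha n).
Context (phi : nat -> X -> Y).
Context (Y_proper : proper_metric Y) (phi_base : forall n, phi n e = y0).
Context (phi_approx : forall n p q,
  mdist p e / alpha n < n.+1%:R -> mdist q e / alpha n < n.+1%:R ->
  `|mdist p q / alpha n - mdist (phi n p) (phi n q)| <= 2 / n.+1%:R).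
Context (phi_surj : forall y, exists2 x : nat -> X,
  \forall n \near \oo, phi n (x n) = y &
  exists C : R, forall n, mdist (x n) e / alpha n < C).

(** The isometry sends the class of [x] to the limit along [mu] of [phi n (x n)]. An admissible
    sequence stays, for almost all [n], in the ball of scaled radius [n.+1], where [phi n] changes
    distances by at most [2 / n.+1]. This error vanishes in the limit. *)
Lemma cone_approx_isometry (mu : set_system nat) (muU : UltraFilter mu) :
  \oo `<=` mu ->
  exists f : cone e muU alpha_gt0 -> Y,
    is_isometry f /\ f (cone_base e muU alpha_gt0) = y0.
Proof.
move=> mu_oo.
have near_mu (P : nat -> Prop) : (\forall n \near \oo, P n) ->
    \forall n \near mu, P n by exact: mu_oo.
have cvg_mu (T : topologicalType) (u : nat -> T) (l : T) :
    u n @[n --> \oo] --> l -> u n @[n --> mu] --> l.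
  by move=> ul A /ul /mu_oo.
have cvg0 : 2 / n.+1%:R @[n --> mu] --> (0 : R).
  apply: cvg_mu; rewrite -[0](mulr0 2); apply: cvgM; first exact: cvg_cst.
  exact: cvg_harmonic.
have adm (x : cone_seq e mu alpha) :
    \forall n \near mu, mdist (sval x n) e / alpha n < n.+1%:R.
  have /asboolP[C C0 Cx] := svalP x; near=> n.
  apply: lt_trans (_ : C < _); first by near: n; exact: Cx.
  rewrite (lt_le_trans (_ : C < n%:R)) ?ler_nat//.
  by near: n; apply: near_mu; exact: nbhs_infty_gtr.
have lim_ex (x : cone_seq e mu alpha) :
    exists y : Y, phi n (sval x n) @[n --> mu] --> y.
  have /asboolP[C C0 Cx] := svalP x.
  (* The images stay within [C + 2] of [y0 = phi n e]: the scaled distance to [e] is below [C] and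
     the distortion is at most 2. Compactness of this ball gives the limit. *)
  have := @Y_proper y0 (C + 2); rewrite compact_ultra.
  move=> /(_ _ (fmap_ultra (fun n => phi n (sval x n)) muU)) [|y [_ ?]].
  2: by exists y.
  suff : \forall n \near mu, mdist y0 (phi n (sval x n)) <= C + 2 by [].
  near=> n.
  have xC : mdist (sval x n) e / alpha n < C by near: n; exact: Cx.
  have xn : mdist (sval x n) e / alpha n < n.+1%:R by near: n; exact: adm.
  have en : mdist e e / alpha n < n.+1%:R by rewrite mdistxx mul0r.
  have := phi_approx xn en; rewrite phi_base (metric_sym _ y0).
  have : 2 / n.+1%:R <= 2 :> R by rewrite ler_pdivrMr// ler_peMr// ler1n.
  rewrite ler_distl; move: xC; set a := _ / alpha n; set b := 2 / _; lra.
have [F FP] := choice lim_ex.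
have Fdist x x' : mdist (F x) (F x') = dinfty x x'.
  suff : mdist (phi n (sval x n)) (phi n (sval x' n)) @[n --> mu] -->
      dinfty x x'.
    move=> xx'; apply/esym; apply: (cvg_unique (@Rhausdorff R) xx').
    exact: cvg_mdist.
  rewrite -[X in _ --> X]subr0.
  (* The distance of the images is split into the scaled distance, which tends to [dinfty x x'],
     minus the distortion, which tends to 0. *)
  rewrite (_ : (fun n => _) = fun n => mdist (sval x n) (sval x' n) / alpha n -
    (mdist (sval x n) (sval x' n) / alpha n -
     mdist (phi n (sval x n)) (phi n (sval x' n)))); last first.
    by apply/funext => n; rewrite subKr.
  apply: cvgB; first exact: dinfty_cvg.
  apply/cvgr0Pnorm_le => r r0.
  move/cvgr0Pnorm_le : cvg0 => /(_ r r0) cvg0r.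
  near=> n; apply: (@le_trans _ _ (2 / n.+1%:R)).
    by apply: phi_approx; near: n; exact: adm.
  rewrite -[leLHS]ger0_norm//; near: n; exact: cvg0r.
(* Since [F] carries [dinfty] to the distance of [Y], equivalent sequences have the same image. *)
have Fpi x : F (repr (\pi_(cone e muU alpha_gt0) x)%qT) = F x.
  apply: mdist_positivity; rewrite Fdist.
  by rewrite -(cone_distE muU alpha_gt0) reprK cone_distxx.
exists (fun p => F (repr p)); split; first split.
- by move=> p q; rewrite Fdist.
- move=> y; have [x xy [C xC]] := phi_surj y.
  have xadm : `[< admissible e mu alpha x >].
    apply/asboolP; exists (Num.max 1 C); first by rewrite lt_max ltr01.
    by apply: nearW => n /=; rewrite lt_max xC orbT.
  exists (\pi_(cone e muU alpha_gt0) (exist _ x xadm))%qT; rewrite Fpi.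
  apply: (cvg_unique (@metric_hausdorff _ Y) (FP _)) => /=.
  apply: cvg_near_cst; exact: near_mu.
- rewrite Fpi.
  apply: (cvg_unique (@metric_hausdorff _ Y) (FP _)) => /=.
  by under eq_fun do rewrite phi_base; exact: cvg_cst.
Unshelve. all: by end_near. Qed.

End ConeOfApproximations.

(** * The squared factorial scale *)

Definition cone_scale (R : realType) (n : nat) : R := (n.+1`! ^ 2)%:R.

Lemma cone_scale_gt0 (R : realType) (n : nat) : 0 < cone_scale R n.
Proof. by rewrite ltr0n expn_gt0 fact_gt0. Qed.

Lemma cone_scale_ge0 (R : realType) (n : nat) : 0 <= cone_scale R n.
Proof. exact: ler0n. Qed.

(** The scale at [n] is [n.+1 ^ 2] times the square of [n!], which supplies both linear factors. One
    offsets the radius of an annulus (outer [m.+1] in [height_le], inner [1 / n.+1] in [height_ge]);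
    the other separates the two scales. *)
Lemma cone_scale_growth (R : realType) (m n : nat) : (m < n)%N ->
  m.+1%:R * n.+1%:R * cone_scale R m <= cone_scale R n.
Proof.
move=> mn; rewrite -!natrM ler_nat (factS n) (expnMn n.+1) leq_mul//.
  by rewrite leq_mul// ltnS ltnW.
by rewrite leq_sqr leq_fact.
Qed.

Lemma cone_scale_ge (R : realType) (n : nat) : n%:R <= cone_scale R n.
Proof.
rewrite ler_nat (leq_trans (leqnSn n))//.
by rewrite (leq_trans (fact_geq _))// -mulnn leq_pmulr// fact_gt0.
Qed.

Lemma cvg_cone_scale (R : realType) : cone_scale R n @[n --> \oo] --> +oo.
Proof.
apply/cvgryPge => A; near=> n.
apply: le_trans (cone_scale_ge R n); near: n; exact: nbhs_infty_ger.
Unshelve. all: by end_near. Qed.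

(** * The wedge of scaled annuli and its metric *)

Section AnnulusWedge.
Context (R : realType) (Y : metricType R) (y0 : Y).
Local Notation alpha := (cone_scale R).

(* The lower bound is 0 for [n = 0]: the basepoint lies in level 0 only. *)
Definition annulus (n : nat) : set Y :=
  [set y | (0 < n)%N%:R <= n.+1%:R * mdist y0 y /\ mdist y0 y <= n.+1%:R].

(** The gluing is carried by [wedge_dist] instead of a quotient: the single copy of [y0], at level
    0, serves as the common basepoint. *)
Definition annulus_wedge : Type := {p : nat * Y | `[< annulus p.1 p.2 >]}.

HB.instance Definition _ := gen_eqMixin annulus_wedge.
HB.instance Definition _ := gen_choiceMixin annulus_wedge.

Definition level (p : annulus_wedge) : nat := (sval p).1.
Definition point (p : annulus_wedge) : Y := (sval p).2.

Lemma annulus_point p : annulus (level p) (point p).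
Proof. exact: asboolW (svalP p). Qed.

Lemma annulus_wedge_eq p q : level p = level q -> point p = point q -> p = q.
Proof.
case: p => [[m y] my]; case: q => [[n z] nz]; rewrite /level /point /=.
by move=> mn yz; subst; congr exist; exact: Prop_irrelevance.
Qed.

Lemma annulus_base : `[< annulus 0 y0 >].
Proof. by apply/asboolP; split; rewrite mdistxx ?mulr0. Qed.

Definition wedge_base : annulus_wedge := exist _ (0%N, y0) annulus_base.

Definition height (p : annulus_wedge) : R :=
  alpha (level p) * mdist y0 (point p).

(** Passing from one level to another means going through the basepoint, hence the sum of
    heights. *)
Definition wedge_dist (p q : annulus_wedge) : R :=
  if level p == level q then alpha (level p) * mdist (point p) (point q)
  else height p + height q.

Lemma height_ge0 p : 0 <= height p.
Proof. by rewrite mulr_ge0 ?mdist_ge0// cone_scale_ge0. Qed.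

Lemma wedge_distxx p : wedge_dist p p = 0.
Proof. by rewrite /wedge_dist eqxx mdistxx mulr0. Qed.

Lemma wedge_dist_sym p q : wedge_dist p q = wedge_dist q p.
Proof.
rewrite /wedge_dist eq_sym metric_sym addrC.
by case: eqP => // ->.
Qed.

Lemma height_eq0 p : height p = 0 -> p = wedge_base.
Proof.
move/eqP; rewrite mulf_eq0 gt_eqF ?cone_scale_gt0//= => /eqP d0.
have /= [+ _] := annulus_point p; rewrite d0 mulr0 lern0.
rewrite eqb0 lt0n negbK => /eqP l0.
by apply: annulus_wedge_eq; rewrite ?l0//; exact/esym/mdist_positivity.
Qed.

Lemma wedge_dist_positivity p q : wedge_dist p q = 0 -> p = q.
Proof.
rewrite /wedge_dist; case: eqP => [lpq /eqP|_ /eqP].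
  rewrite mulf_eq0 gt_eqF ?cone_scale_gt0//= => /eqP d0.
  by apply: annulus_wedge_eq => //; exact: mdist_positivity.
by rewrite paddr_eq0 ?height_ge0// => /andP[/eqP/height_eq0 -> /eqP/height_eq0].
Qed.

Lemma wedge_dist_triangle q p r :
  wedge_dist p r <= wedge_dist p q + wedge_dist q r.
Proof.
have tri (x y z : annulus_wedge) : level x = level y -> level y = level z ->
    alpha (level x) * mdist (point x) (point z) <=
    alpha (level x) * mdist (point x) (point y) +
    alpha (level y) * mdist (point y) (point z).
  move=> <- _; rewrite -mulrDr ler_wpM2l ?metric_triangle//.
have h_le (x y : annulus_wedge) : level x = level y ->
    height x <= alpha (level x) * mdist (point x) (point y) + height y.
  move=> xy; rewrite /height -xy -mulrDr ler_wpM2l//.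
  by rewrite addrC (metric_sym (point x)) metric_triangle.
have le_h (x y : annulus_wedge) : level x = level y ->
    alpha (level x) * mdist (point x) (point y) <= height x + height y.
  move=> xy; rewrite /height -xy -mulrDr ler_wpM2l//.
  by rewrite (metric_sym y0 (point x)) metric_triangle.
have h0 := height_ge0 q.
rewrite /wedge_dist.
case: (eqVneq (level p) (level q)) => [pq|pq];
  case: (eqVneq (level q) (level r)) => [qr|qr].
- by rewrite ifT ?tri// pq qr.
- by rewrite ifN ?pq// -?pq addrA lerD2r h_le.
- rewrite ifN -?qr// -addrA lerD2l addrC (metric_sym (point q)) qr.
  exact: h_le.
- case: eqP => [pr|_]; last lra.
  apply: le_trans (le_h _ _ pr) _; lra.
Qed.

HB.instance Definition _ := @isMetric.Build R annulus_wedge wedge_dist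
  wedge_distxx wedge_dist_positivity wedge_dist_sym wedge_dist_triangle.

Lemma mdist_wedge_base p : mdist wedge_base p = height p.
Proof.
rewrite -[LHS]/(wedge_dist wedge_base p) /wedge_dist [height wedge_base]/height.
by rewrite mdistxx mulr0 add0r /height; case: eqP => // <-.
Qed.

(** * Properness of the wedge *)

Lemma annulus_compact (n : nat) : proper_metric Y -> compact (annulus n).
Proof.
move=> Yp.
rewrite (_ : annulus n = [set y | mdist y0 y <= n.+1%:R] `&`
  [set y | (0 < n)%N%:R / n.+1%:R <= mdist y0 y]); last first.
  apply/seteqP; split=> y /=; rewrite ler_pdivrMr ?ltr0n// mulrC;
  by move=> -[? ?]; split.
by apply: compact_closedI; [exact: Yp|exact: closed_mdist_ge].
Qed.

(** On one level [point] multiplies distances by the constant [1 / alpha n], so a limit found in the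
    compact annulus lifts to the level. *)
Lemma level_compact (n : nat) :
  proper_metric Y -> compact [set p | level p = n].
Proof.
move=> Yp; rewrite compact_ultra => F FU Fn.
have := @annulus_compact n Yp; rewrite compact_ultra.
move=> /(_ _ (fmap_ultra point FU)) [|y [ny Fy]].
  suff : F (point @^-1` annulus n) by [].
  by apply: filterS Fn => p <-; exact: annulus_point.
have /asboolP py : annulus n y := ny.
exists (exist _ (n, y) py); split => //=.
apply/metricType_numDomainType.fcvgrPdist_lt => r r0; near=> q.
have qn : level q = n by near: q; exact: Fn.
rewrite -[mdist _ _]/(wedge_dist _ _) /wedge_dist qn eqxx.
rewrite mulrC -ltr_pdivlMr ?cone_scale_gt0//.
near: q.
have rn : 0 < r / alpha n by rewrite divr_gt0 ?cone_scale_gt0.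
move/metricType_numDomainType.cvgrPdist_lt : Fy; exact.
Unshelve. all: by end_near. Qed.

Lemma height_ge (n : nat) p : (n < level p)%N -> n.+1%:R * alpha n <= height p.
Proof.
move=> np; rewrite /height; have [+ _] := annulus_point p.
rewrite (leq_ltn_trans (leq0n n) np) => d1.
have := cone_scale_growth R np.
rewrite mulrAC => /(ler_wpM2r (mdist_ge0 y0 (point p))).
by apply: le_trans; rewrite -[leRHS]mulrA -[leLHS]mulr1 ler_wpM2l// mulr_ge0.
Qed.

Lemma height_le (n : nat) p : (level p < n)%N -> height p <= alpha n / n.+1%:R.
Proof.
move=> pn; rewrite /height; have [_ d1] := annulus_point p.
rewrite ler_pdivlMr ?ltr0n//; apply: le_trans (cone_scale_growth R pn).
by rewrite -[leLHS]mulrA [leRHS]mulrC ler_wpM2l// ler_wpM2r.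
Qed.

(** By [height_ge] heights grow with the level, so a ball meets only finitely many levels, each of
    them compact. *)
Lemma annulus_wedge_proper : proper_metric Y -> proper_metric annulus_wedge.
Proof.
move=> Yp p r.
pose N := Num.trunc (r + height p).
pose L n := [set q | level q = n].
apply: (@subclosed_compact _ _ (\big[setU/set0]_(n < N.+2) L n)).
- exact: closed_mdist_le.
- by apply: bigsetU_compact => n _; exact: level_compact.
(* A level above [N.+1] would force height at least [N.+2 * alpha N.+1], too large for the ball.
   Using index [N.+1] rather than [N] gives [1 <= alpha N.+1] directly from [cone_scale_ge]. *)
- move=> q /= qr; rewrite -(bigcup_mkord N.+2 L); exists (level q) => //=.
  rewrite ltnNge; apply/negP => lq.
  have := height_ge lq; apply/negP; rewrite -ltNge.
  have hq : height q <= r + height p.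
    rewrite -!mdist_wedge_base; apply: le_trans (metric_triangle _ p _) _.
    by rewrite addrC lerD2r.
  have h0 : 0 <= r + height p := le_trans (height_ge0 q) hq.
  apply: (le_lt_trans hq).
  have := truncnS_gt (r + height p); rewrite -/N => /lt_le_trans; apply.
  rewrite (le_trans (_ : _ <= N.+2%:R))// ?ler_nat// ler_peMr//.
  by rewrite (le_trans _ (cone_scale_ge R N.+1))// ler1n.
Qed.

(** * Projections of the wedge onto single layers, playing the role of [phi] *)

Definition layer (n : nat) (p : annulus_wedge) : Y :=
  if level p == n then point p else y0.

Lemma layer_base (n : nat) : layer n wedge_base = y0.
Proof. by rewrite /layer; case: ifP. Qed.

(** On level [n] the scaled distance is exactly that of [Y]. Within scaled radius [n.+1] there is no
    higher level, and a point of a lower level has scaled height at most [1 / n.+1]; collapsing two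
    such points costs at most [2 / n.+1]. *)
Lemma layer_approx (n : nat) p q :
  mdist p wedge_base / alpha n < n.+1%:R ->
  mdist q wedge_base / alpha n < n.+1%:R ->
  `|mdist p q / alpha n - mdist (layer n p) (layer n q)| <= 2 / n.+1%:R.
Proof.
have an := cone_scale_gt0 R n.
have small s : level s != n -> mdist s wedge_base / alpha n < n.+1%:R ->
    0 <= height s / alpha n <= 1 / n.+1%:R.
  move=> sn; rewrite metric_sym mdist_wedge_base => hs.
  rewrite divr_ge0 ?height_ge0 ?(ltW an)//= ler_pdivrMr// mul1r mulrC.
  move: sn; rewrite neq_ltn => /orP[|/height_ge]; first exact: height_le.
  by move: hs; rewrite ltr_pdivrMr// => /lt_le_trans/[apply]; rewrite ltxx.
have heightE s : level s = n -> height s / alpha n = mdist y0 (point s).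
  by move=> sn; rewrite /height sn mulrC mulKf// gt_eqF.
rewrite [mdist p q]/(wedge_dist p q) /wedge_dist /layer.
case: (eqVneq (level p) n) => [pn|pn] hp;
  case: (eqVneq (level q) n) => [qn|qn] hq.
- by rewrite pn qn eqxx mulrC mulKf ?gt_eqF// subrr normr0.
- rewrite pn eq_sym (negbTE qn) mulrDl heightE//.
  rewrite (metric_sym y0) addrAC subrr add0r.
  have := small _ qn hq; rewrite -[2]/(1 + 1) mulrDl => /andP[h0 h1].
  by rewrite ger0_norm// (le_trans h1)// lerDl.
- rewrite qn (negbTE pn) mulrDl (heightE q)// addrK.
  have := small _ pn hp; rewrite -[2]/(1 + 1) mulrDl => /andP[h0 h1].
  by rewrite ger0_norm// (le_trans h1)// lerDl.
- rewrite mdistxx subr0 ger0_norm; last first.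
    by rewrite divr_ge0 ?(ltW an)//; exact: (mdist_ge0 p q).
  have /andP[_ p1] := small _ pn hp; have /andP[_ q1] := small _ qn hq.
  apply: (@le_trans _ _ (height p / alpha n + height q / alpha n)).
    rewrite -mulrDl ler_pM2r ?invr_gt0//.
    case: eqP => // pq; rewrite /height pq -mulrDr ler_pM2l ?cone_scale_gt0//.
    by rewrite (metric_sym y0 (point p)) metric_triangle.
  by rewrite -[2]/(1 + 1) mulrDl lerD.
Qed.

(** A point other than [y0] lies in all annuli of large index, and its copy at level [n] has scaled
    height exactly [mdist y0 y]. The basepoint fills the remaining indices. *)
Lemma layer_surj (y : Y) : exists2 x : nat -> annulus_wedge,
  \forall n \near \oo, layer n (x n) = y &
  exists C : R, forall n, mdist (x n) wedge_base / alpha n < C.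
Proof.
have xP n : exists x : annulus_wedge,
    (annulus n y -> layer n x = y) /\
    mdist x wedge_base / alpha n < mdist y0 y + 1.
  have [/asboolP ny|ny] := pselect (annulus n y).
    exists (exist _ (n, y) ny); rewrite /layer /= eqxx; split=> //.
    rewrite metric_sym mdist_wedge_base /height mulrC mulKf ?ltrDl//.
    by rewrite gt_eqF// cone_scale_gt0.
  by exists wedge_base; split=> //; rewrite mdistxx mul0r ltr_wpDl// mdist_ge0.
have [x xy] := choice xP.
(* The point [y0] lies in no annulus of positive index, so it is reached by the constant sequence at
   the basepoint. *)
have [->|yy0] := eqVneq y y0.
  exists (fun=> wedge_base); first by apply: nearW => n; exact: layer_base.
  by exists 1 => n; rewrite mdistxx mul0r.
exists x; last by exists (mdist y0 y + 1) => n; have [] := xy n.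
near=> n; apply: (xy n).1; split.
  rewrite (@le_trans _ _ 1) ?lern1 ?leq_b1//.
  rewrite -ler_pdivrMr ?mdist_gt0 1?eq_sym// mul1r ltW//.
  rewrite (@lt_le_trans _ _ n%:R) ?ler_nat//.
  near: n; exact: nbhs_infty_gtr.
rewrite ltW// (@lt_le_trans _ _ n%:R) ?ler_nat//.
near: n; exact: nbhs_infty_gtr.
Unshelve. all: by end_near. Qed.

End AnnulusWedge.

(** * Iterated wedges and iterated cones *)

Definition pointed_wedge (R : realType) (P : pointed_metric R) :
    pointed_metric R :=
  PointedMetric (wedge_base (pm_base P)).

Lemma iter_wedge_proper (R : realType) (P : pointed_metric R) (k : nat) :
  proper_metric (pm_space P) ->
  proper_metric (pm_space (iter k (@pointed_wedge R) P)).
Proof. by move=> Pp; elim: k => //= k; exact: annulus_wedge_proper. Qed.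

(** Induction on [k] with [P] varying: the inner [k] cones undo the outer [k] wedges and leave the
    wedge of [P], which the last cone turns into [P]. Basepoints are tracked because the next cone
    is taken at the base of the previous one. *)
Lemma iter_cone_wedge (R : realType) (mu : set_system nat)
    (muU : UltraFilter mu) (k : nat) (P : pointed_metric R) :
  \oo `<=` mu -> proper_metric (pm_space P) ->
  let C := iter_cone (pm_base (iter k (@pointed_wedge R) P)) muU
    (@cone_scale_gt0 R) k in
  exists f : pm_space C -> pm_space P,
    is_isometry f /\ f (pm_base C) = pm_base P.
Proof.
move=> mu_oo; elim: k P => [|k IHk] P Pp.
  by exists id; do 2!split=> //; move=> y; exists y.
rewrite iterSr /=.
have [g [[gd gs] ge]] := IHk (pointed_wedge P) (annulus_wedge_proper Pp).
(* Composing the layers with the pointed isometry [g] makes them approximations on the iterated cone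
   itself, so no separate transport of cones along isometries occurs. *)
apply: (@cone_approx_isometry _ _ _ _ _ _ _ (fun n p => layer n (g p))) => //.
- by move=> n; rewrite ge layer_base.
- by move=> n p q; rewrite -(gd p) -(gd q) -(gd p q) ge; exact: layer_approx.
- move=> y; have [x xy [C xC]] := layer_surj (pm_base P) y.
  have [z zx] := choice (fun n => gs (x n)).
  exists z; first by apply: filterS xy => n; rewrite zx.
  by exists C => n; rewrite -gd zx ge.
Qed.

Theorem corollary4p2 (R : realType) (Y : metricType R)
    (Y_neq0 : [set: Y] !=set0) (Y_proper : proper_metric Y) (k : nat) :
  exists (X : metricType R) (e : X)
         (alpha : nat -> R) (alpha_gt0 : forall n : nat, 0 < alpha n),
    proper_metric X /\
    alpha n @[n --> \oo] --> +oo%R /\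
    forall (mu : set_system nat) (muU : UltraFilter mu),
      non_principal mu ->
      exists f : pm_space (iter_cone e muU alpha_gt0 k) -> Y, is_isometry f.
Proof.
have [y0 _] := Y_neq0; pose P := PointedMetric y0.
pose X := iter k (@pointed_wedge R) P.
exists (pm_space X), (pm_base X), (cone_scale R), (@cone_scale_gt0 R).
split; first exact: iter_wedge_proper.
split; first exact: cvg_cone_scale.
move=> mu muU /non_principal_cofinite mu_oo.
by have [f [fi _]] := @iter_cone_wedge R mu muU k P mu_oo Y_proper; exists f.
Qed.
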